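(* Let $P$ be a simple thin polyomino and let $G=G_P$. Then the complement graph $\bar G$ is chordal if and only if $P$ is a short brush polyomino.
   Context: A cell is a unit square $[a,a+(1,1)]$ with $a\in\mathbb{N}^2$; $a$ is its lower left corner. Two cells are adjacent if they share an edge. A polyomino $P$ is a nonempty finite set of cells such that any two cells of $P$ are joined by a sequence of cells of $P$ in which consecutive cells are adjacent. $P$ is simple (roughly, has no hole) if any two cells of $\mathbb{N}^2$ not belonging to $P$ are joined by a sequence of cells not belonging to $P$ in which consecutive cells are adjacent. $P$ is thin if it does not contain a $2\times 2$ square of cells. $G_P$ is the graph whose vertices are the cells of $P$ and whose edges are the pairs $\{C,D\}$ of distinct cells of $P$ such that $C$ and $D$ lie on the same row or column. The complement graph $\bar G$ of $G$ has the same vertex set and its edges are the non-edges of $G$. A graph is chordal if it has no induced cycle of length at least $4$. A cell interval of $P$ is a set of at least two consecutive cells of $P$ in one row or in one column of the grid; $\mathcal{C}$ denotes the set of all cell intervals of $P$ that are maximal with respect to inclusion, and $|I|$ is the number of cells of $I$. For cell intervals $I,J$, $I\cap J$ is the set of their common cells. A brush polyomino is a simple thin polyomino $P$ such that $\mathcal{C}=\{J,I_1,\dots,I_l\}$ with $0\le l\le |J|$ and $I_k\cap J\neq\varnothing$ for every $k\in\{1,\dots,l\}$. If in addition $|I_k|=2$ for every $k\in\{1,\dots,l\}$, then $P$ is called a short brush polyomino.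
   Formalization: P is assumed to have at least two cells: a single cell has chordal complement graph but no cell interval, so it is not a brush. ''Same row or column'' means lying in a common cell interval of P; cells of a grid line separated by a gap are not adjacent in G_P. *)

(* Defs.v *)
From mathcomp Require Import all_boot finmap.

Set Implicit Arguments.
Unset Strict Implicit.
Unset Printing Implicit Defensive.

(** ** Graphs *)

Definition compl_graph (T : Type) (e : T -> T -> Prop) (x y : T) : Prop :=
  x <> y /\ ~ e x y.

(* [next c] is the successor in [c] read cyclically, so for [2 < size c] the
   pairs below are exactly the edges of the cycle [c]. *)
Definition induced_cycle (T : eqType) (e : T -> T -> Prop) (c : seq T) : Prop :=
  uniq c /\
  forall x y : T, x \in c -> y \in c ->
    (e x y <-> y = next c x \/ x = next c y).

Definition chordal (T : eqType) (e : T -> T -> Prop) : Prop :=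
  forall c : seq T, 4 <= size c -> ~ induced_cycle e c.

(** ** Polyominoes *)

(* A cell is represented by its lower left corner. *)
Definition cell : Type := (nat * nat)%type.

Definition adjacent (a b : cell) : bool :=
  ((a.2 == b.2) && ((b.1 == a.1.+1) || (a.1 == b.1.+1))) ||
  ((a.1 == b.1) && ((b.2 == a.2.+1) || (a.2 == b.2.+1))).

Definition cell_connected (S : pred cell) : Prop :=
  forall a b : cell, S a -> S b ->
    exists s : seq cell, [/\ path adjacent a s, last a s = b & all S s].

Definition polyomino (P : {fset cell}) : Prop :=
  P != fset0%fset /\ cell_connected [pred a | a \in P].

(* The complement is taken in the quadrant N^2, not in Z^2. *)
Definition simple_polyomino (P : {fset cell}) : Prop :=
  cell_connected [pred a | a \notin P].

Definition thin (P : {fset cell}) : Prop :=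
  forall i j : nat,
    ~ [/\ (i, j) \in P, (i.+1, j) \in P, (i, j.+1) \in P & (i.+1, j.+1) \in P].

Definition row_run (a : cell) (n : nat) : {fset cell} :=
  [fset ((a.1 + k)%N, a.2) | k in iota 0 n]%fset.

Definition col_run (a : cell) (n : nat) : {fset cell} :=
  [fset (a.1, (a.2 + k)%N) | k in iota 0 n]%fset.

Definition cell_interval (P I : {fset cell}) : Prop :=
  (I `<=` P)%fset /\
  exists (a : cell) (n : nat), 2 <= n /\ (I = row_run a n \/ I = col_run a n).

Definition maximal_cell_interval (P I : {fset cell}) : Prop :=
  cell_interval P I /\
  forall K : {fset cell}, cell_interval P K -> (I `<=` K)%fset -> K = I.

(* "On the same row or column" refers to the rows and columns of [P], that is,
   to its cell intervals: cells of one grid line that are separated by a cell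
   outside [P] are not joined by an edge. *)
Definition polyomino_graph (P : {fset cell}) (C D : P) : Prop :=
  C <> D /\
  exists I : {fset cell}, [/\ cell_interval P I, val C \in I & val D \in I].

(* The maximal cell intervals of [P] are [J] and the entries I_1, ..., I_l of
   [Is], where l = [size Is]. *)
Definition brush_polyomino
    (P J : {fset cell}) (Is : seq {fset cell}) : Prop :=
  [/\ polyomino P, simple_polyomino P & thin P] /\
  [/\ uniq (J :: Is),
      forall K : {fset cell}, maximal_cell_interval P K <-> K \in J :: Is,
      size Is <= #|` J|
    & forall I : {fset cell}, I \in Is -> (I `&` J)%fset != fset0].

Definition short_brush_polyomino (P : {fset cell}) : Prop :=
  exists (J : {fset cell}) (Is : seq {fset cell}),
    brush_polyomino P J Is /\
    forall I : {fset cell}, I \in Is -> #|` I| = 2.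

(* Main.v *)
Require Import Defs.
From mathcomp Require Import all_boot finmap.
From mathcomp Require Import zify.

(** If the complement of the graph of [P] is chordal, then the graph has no
    induced pair of disjoint edges (2K2), whose complement is a 4-cycle.  Hence
    perpendicular maximal intervals meet and cannot both have three cells, and
    two parallel ones both have two cells and are joined by a perpendicular
    rung.  If some maximal interval has three cells, it is therefore the spine
    of the brush.  Otherwise all of them have two cells: take any [J] if it has
    no parallel, and else a rung [V] between [J] and a parallel of it, since a
    parallel of [V] would close up a 2x2 square.  Conversely, the graph of a
    short brush is a split graph: the spine is a clique and the cells off the
    spine are pairwise non-adjacent. *)

(** * Coordinates and straight segments relative to a direction *)

(* [b = false] is the horizontal direction, [b = true] the vertical one. *)
Definition across (b : bool) (c : cell) : nat := if b then c.1 else c.2.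
Definition along (b : bool) (c : cell) : nat := if b then c.2 else c.1.
Definition pt (b : bool) (r k : nat) : cell := if b then (r, k) else (k, r).

Definition run (b : bool) (c : cell) (n : nat) : {fset cell} :=
  if b then col_run c n else row_run c n.

(* The straight segment from [c] to [d] in direction [b] lies inside [P]. *)
Definition lin (P : {fset cell}) (b : bool) (c d : cell) : bool :=
  (across b c == across b d) &&
  [forall k : 'I_(maxn (along b c) (along b d)).+1,
     (minn (along b c) (along b d) <= k) ==> (pt b (across b c) k \in P)].

(** The class of [c] under the relation [lin P b], empty when [c] is outside [P]. It may be a single
    cell, and only otherwise is it a cell interval. *)
Definition line (P : {fset cell}) (b : bool) (c : cell) : {fset cell} :=
  [fset d in P | lin P b c d]%fset.

Lemma pt_across_along b c : pt b (across b c) (along b c) = c.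
Proof. by case: b c => [] []. Qed.

Lemma across_pt b r k : across b (pt b r k) = r.
Proof. by case: b. Qed.

Lemma along_pt b r k : along b (pt b r k) = k.
Proof. by case: b. Qed.

Lemma pt_negb b r k : pt (~~ b) r k = pt b k r.
Proof. by case: b. Qed.

Lemma across_negb b c : across (~~ b) c = along b c.
Proof. by case: b. Qed.

Lemma along_negb b c : along (~~ b) c = across b c.
Proof. by case: b. Qed.

Lemma mem_run b c n d :
  (d \in run b c n) =
  (across b d == across b c) && (along b c <= along b d < along b c + n).
Proof.
case: b c d => [] [c1 c2] [d1 d2]; rewrite /run /col_run /row_run /=;
  apply/imfsetP/andP => [[k]|[/eqP-> h]] /=.
- by rewrite mem_iota => hk [-> ->]; split=> //; lia.
- by exists (d2 - c2); [rewrite mem_iota; lia | congr pair; lia].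
- by rewrite mem_iota => hk [-> ->]; split=> //; lia.
- by exists (d1 - c1); [rewrite mem_iota; lia | congr pair; lia].
Qed.

Lemma linP {P b c d} :
  reflect (across b c = across b d /\
           forall k, minn (along b c) (along b d) <= k <=
                     maxn (along b c) (along b d) ->
                     pt b (across b c) k \in P)
          (lin P b c d).
Proof.
apply: (iffP andP) => [[/eqP h /forallP H]|[/eqP h H]]; split=> //.
  move=> k /andP[k1 k2].
  by move: (H (Ordinal (k2 : k < _.+1))); rewrite /= k1.
apply/forallP=> k; apply/implyP=> hk; apply: H.
by rewrite hk -ltnS ltn_ord.
Qed.

(** * Segments inside [P] as a partial equivalence relation *)

Section Lines.
Context {P : {fset cell}}.

Lemma lin_memr {b c d} : lin P b c d -> d \in P.
Proof.
case/linP=> h /(_ (along b d)); rewrite h pt_across_along; apply; lia.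
Qed.

Lemma lin_sym {b c d} : lin P b c d -> lin P b d c.
Proof.
by case/linP=> h H; apply/linP; split=> // k; rewrite -h minnC maxnC; apply: H.
Qed.

Lemma lin_meml {b c d} : lin P b c d -> c \in P.
Proof. by move/lin_sym/lin_memr. Qed.

Lemma lin_refl b c : c \in P -> lin P b c c.
Proof.
move=> cP; apply/linP; split=> // k; rewrite minnn maxnn => hk.
have -> : k = along b c by lia.
by rewrite pt_across_along.
Qed.

Lemma lin_refll {b c d} : lin P b c d -> lin P b c c.
Proof. by move/lin_meml/lin_refl. Qed.

Lemma lin_trans {b c d e} : lin P b c d -> lin P b d e -> lin P b c e.
Proof.
case/linP=> h H /linP[h' H']; apply/linP; split; first by rewrite h.
move=> k hk; case: (boolP (minn (along b c) (along b d) <= k <=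
                     maxn (along b c) (along b d))) => hk'; first exact: H.
by rewrite h; apply: H'; lia.
Qed.

(** The two links fix both coordinates. This is the form in which perpendicular lines are known to
    share at most one cell. *)
Lemma lin_cross {b c d} : lin P b c d -> lin P (~~ b) c d -> c = d.
Proof.
case/linP=> h _ /linP[h' _]; rewrite -(pt_across_along b c) h.
by move: h'; rewrite !across_negb => ->; rewrite pt_across_along.
Qed.

Lemma mem_line b c d : (d \in line P b c) = lin P b c d.
Proof. by rewrite !inE /= andb_idl // => /lin_memr. Qed.

Lemma line_eq {b c d} : lin P b c d -> line P b c = line P b d.
Proof.
move=> h; apply/fsetP=> e; rewrite !mem_line.
by apply/idP/idP; apply: lin_trans => //; apply: lin_sym.
Qed.

Lemma lin_run b c n d e : (run b c n `<=` P)%fset ->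
  d \in run b c n -> e \in run b c n -> lin P b d e.
Proof.
move=> /fsubsetP sP; rewrite !mem_run => /andP[/eqP h hd] /andP[/eqP h' he].
apply/linP; split; first by rewrite h.
move=> k hk; apply: sP; rewrite mem_run across_pt along_pt h eqxx /=; lia.
Qed.

(** * Maximal cell intervals as lines with at least two cells *)

Lemma cell_intervalP I :
  cell_interval P I <->
  (I `<=` P)%fset /\ exists b c n, 2 <= n /\ I = run b c n.
Proof.
split=> -[sP].
  by case=> c [n [n2 [eI|eI]]]; split=> //; [exists false | exists true]; exists c, n.
by case=> -[] [c [n [n2 eI]]]; split=> //; exists c, n; split=> //; [right|left].
Qed.

Lemma maximal_is_line {M} : maximal_cell_interval P M ->
  exists b c d, [/\ c != d, lin P b c d & M = line P b c].
Proof.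
case=> /cell_intervalP[sP [b [c [n [n2 eM]]]]] maxM.
pose d := pt b (across b c) (along b c).+1.
have cM : c \in M by rewrite eM mem_run eqxx; lia.
have dM : d \in M by rewrite eM mem_run across_pt along_pt eqxx; lia.
have lcd : lin P b c d by apply: (@lin_run b c n); rewrite -?eM.
exists b, c, d; split=> //.
  by apply/eqP=> /(congr1 (along b)); rewrite along_pt; lia.
apply/fsetP=> e; rewrite mem_line; apply/idP/idP => [eM'|ce].
  by apply: (@lin_run b c n); rewrite -?eM.
(* [K] is the hull of [M] and [e]. The segment from [c] to [e] fills the gap, so [K] stays in [P],
   and maximality of [M] forces [e] into [M]. *)
pose K := run b (pt b (across b c) (minn (along b c) (along b e)))
  (maxn (along b c + n) (along b e).+1 - minn (along b c) (along b e)).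
have eMK : e \in K.
  by case/linP: ce => h _; rewrite mem_run across_pt along_pt h eqxx; lia.
rewrite -(maxM K) //.
- apply/cell_intervalP; split; last first.
    by exists b, (pt b (across b c) (minn (along b c) (along b e))); eexists;
      split; [|reflexivity]; lia.
  apply/fsubsetP=> x; rewrite mem_run across_pt along_pt => /andP[/eqP hx hx'].
  case: (boolP (x \in M)) => [|xM]; first exact: (fsubsetP sP).
  case/linP: ce => h /(_ (along b x)); rewrite -hx pt_across_along; apply.
  by move: xM; rewrite eM mem_run hx eqxx; lia.
- apply/fsubsetP=> x; rewrite eM !mem_run across_pt along_pt => /andP[-> hx] /=.
  lia.
Qed.

Lemma line_is_maximal {b c d} : c != d -> lin P b c d ->
  maximal_cell_interval P (line P b c).
Proof.
move=> cd lcd.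
(* The line is recovered as the run between the least and the greatest coordinate satisfying [p];
   the greatest exists because [P] is finite. *)
pose p k := lin P b c (pt b (across b c) k).
have pc : p (along b c).
  by rewrite /p pt_across_along; apply: (lin_refll lcd).
have bnd k : p k -> k <= \max_(x <- P) along b x.
  move=> /lin_memr kP; have {1}<- := along_pt b (across b c) k.
  exact: leq_bigmax_seq.
have pE x : lin P b c x -> p (along b x).
  by move=> lx; rewrite /p; case/linP: (lx) => -> _; rewrite pt_across_along.
have exp : exists k, p k by exists (along b c).
case: (ex_minnP exp) => lo plo minlo; case: (ex_maxnP exp bnd) => hi phi maxhi.
have lohi : lo < hi.
  case/linP: (lcd) => h _.
  have := (minlo _ pc, maxhi _ pc, minlo _ (pE _ lcd), maxhi _ (pE _ lcd)).
  move=> [[[h1 h2] h3] h4].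
  have : along b c <> along b d.
    move=> h'; case/eqP: cd; rewrite -(pt_across_along b c) h h'.
    exact: pt_across_along.
  lia.
have eL : line P b c = run b (pt b (across b c) lo) (hi - lo).+1.
  apply/fsetP=> x; rewrite mem_line mem_run across_pt along_pt.
  apply/idP/andP => [lx|[/eqP hx hx']].
    case/linP: (lx) => -> _; rewrite eqxx; split=> //.
    by have := minlo _ (pE _ lx); have := maxhi _ (pE _ lx); lia.
  have /linP[_ H] := lin_trans (lin_sym plo) phi.
  apply: (lin_trans plo); apply/linP; rewrite !across_pt !along_pt; split=> //.
  by move=> k hk; move: (H k); rewrite !along_pt across_pt; apply; lia.
split.
  apply/cell_intervalP; split; first by apply/fsubsetP=> x; rewrite mem_line => /lin_memr.
  by exists b, (pt b (across b c) lo), (hi - lo).+1; split=> //; lia.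
move=> K /cell_intervalP[sK [b' [a [n [_ eK]]]]] /fsubsetP sLK.
have cK : c \in K by apply: sLK; rewrite mem_line (lin_refll lcd).
have dK : d \in K by apply: sLK; rewrite mem_line.
have linK x y : x \in K -> y \in K -> lin P b' x y.
  by move=> xK yK; apply: (@lin_run b' a n); rewrite -?eK.
(* A run in the other direction cannot contain the distinct cells [c] and [d] of one [b]-line. *)
have eb : b' = b.
  apply/eqP/negPn/negP => /eqP nb; case/eqP: cd; apply: (lin_cross lcd).
  have -> : ~~ b = b' by case: (b) (b') nb => [] [].
  exact: linK.
apply/eqP; rewrite eqEfsubset; apply/andP; split; last exact/fsubsetP.
by apply/fsubsetP=> x xK; rewrite mem_line -eb linK.
Qed.

Lemma card_gt1P (A : {fset cell}) :
  reflect (exists x y, [/\ x \in A, y \in A & x != y]) (1 < #|` A|).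
Proof.
apply: (iffP idP) => [h|[x [y [xA yA xy]]]].
  have /fset0Pn[x xA] : A != fset0 by rewrite -cardfs_gt0; lia.
  have /fset0Pn[y] : (A `\ x)%fset != fset0.
    by rewrite -cardfs_gt0; move: h; rewrite (cardfsD1 x) xA.
  by rewrite !inE => /andP[yx yA]; exists x, y; rewrite eq_sym.
rewrite (cardfsD1 x) xA (cardfsD1 y) !inE eq_sym xy yA; lia.
Qed.

Lemma maximalP M : maximal_cell_interval P M <->
  1 < #|` M| /\ exists b c, c \in P /\ M = line P b c.
Proof.
split=> [/maximal_is_line[b [c [d [cd lcd ->]]]]|[/card_gt1P[x [y [xM yM xy]]] [b [c [cP eM]]]]].
  split; last by exists b, c; split=> //; apply: lin_meml lcd.
  apply/card_gt1P; exists c, d; rewrite !mem_line; split=> //.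
  exact: lin_refll lcd.
move: xM yM; rewrite eM !mem_line => lx ly.
rewrite (line_eq lx); apply: (@line_is_maximal _ _ y) => //.
exact: lin_trans (lin_sym lx) ly.
Qed.

Lemma graphP (C D : P) : polyomino_graph C D <->
  C <> D /\ exists b, lin P b (val C) (val D).
Proof.
split=> -[nCD].
  case=> I [/cell_intervalP[sP [b [c [n [_ eI]]]]] CI DI]; split=> //; exists b.
  by apply: (@lin_run b c n); rewrite -?eI.
case=> b lCD; split=> //; exists (line P b (val C)).
have [|iL _] := @line_is_maximal _ _ _ _ lCD; first by apply/eqP=> /val_inj.
by split=> //; rewrite mem_line //; apply: (lin_refll lCD).
Qed.


(** * Adjacent cells, thinness and rungs *)

Lemma adjacent_lin a b : a \in P -> b \in P -> adjacent a b ->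
  exists d, lin P d a b.
Proof.
move=> aP bP; case: a b aP bP => [a1 a2] [b1 b2] aP bP.
have H d x y : x \in P -> y \in P -> across d x = across d y ->
    (along d y == (along d x).+1) || (along d x == (along d y).+1) -> lin P d x y.
  move=> xP yP h h'; apply/linP; split=> // k hk.
  have [->|->] : k = along d x \/ k = along d y by lia.
    by rewrite pt_across_along.
  by rewrite h pt_across_along.
by case/orP=> /andP[/eqP h1 h2]; [exists false | exists true]; apply: H.
Qed.

Lemma thin_pt b r k : thin P -> pt b r k \in P -> pt b r k.+1 \in P ->
  pt b r.+1 k \in P -> pt b r.+1 k.+1 \in P -> False.
Proof.
by move=> thP; case: b => /= h1 h2 h3 h4; [apply: (thP r k) | apply: (thP k r)].
Qed.

(** The rungs over two consecutive cells bound a strip of width two lying entirely in [P]. If its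
    height were positive, it would contain a 2x2 square. *)
Lemma thin_no_two_rungs {b c c' x x'} : thin P ->
  lin P b c c' -> along b c' = (along b c).+1 ->
  lin P (~~ b) c x -> lin P (~~ b) c' x' -> lin P b x x' -> c = x.
Proof.
move=> thP lcc sc lcx lcx' lxx; apply: (@lin_cross b) => //.
case/linP: lcc => rc _; case/linP: lxx => rx _.
case/linP: lcx; rewrite !across_negb !along_negb => kx Hx.
case/linP: lcx'; rewrite !across_negb !along_negb => kx' Hx'.
have E r : minn (across b c) (across b x) <= r <= maxn (across b c) (across b x) ->
    pt b r (along b c) \in P /\ pt b r (along b c).+1 \in P.
  by move=> hr; split; rewrite -pt_negb -?sc; [apply: Hx | apply: Hx'; rewrite -rc -rx].
have contra r : minn (across b c) (across b x) <= r ->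
    r.+1 <= maxn (across b c) (across b x) -> False.
  move=> h h'; case: (E r) => [|p1 p2]; first lia.
  by case: (E r.+1) => [|p3 p4]; [lia | apply: (thin_pt b r (along b c))].
have -> : c = x; last first.
  by apply: lin_refl; have := E (across b x); rewrite kx pt_across_along; case=> //; lia.
rewrite -(pt_across_along b c) -(pt_across_along b x) kx; congr pt.
case: (ltngtP (across b c) (across b x)) => // h; exfalso.
  by apply: (contra (across b c)); lia.
by apply: (contra (across b x)); lia.
Qed.

Lemma lin_consecutive {b c d} : lin P b c d -> c != d ->
  exists u v, [/\ lin P b c u, lin P b u v & along b v = (along b u).+1].
Proof.
move=> lcd cd; case/linP: (lcd) => h H.
have ncd : along b c <> along b d.
  move=> h'; case/eqP: cd; rewrite -(pt_across_along b c) h h'.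
  exact: pt_across_along.
(* The pair is taken at the lower end of the segment, since [c] may lie on either side of [d]. *)
pose m := minn (along b c) (along b d).
exists (pt b (across b c) m), (pt b (across b c) m.+1).
rewrite !along_pt; split=> //; apply/linP;
  by rewrite !across_pt !along_pt; split=> // k hk; apply: H; lia.
Qed.

Lemma card_gt2_avoid (A : {fset cell}) z : 2 < #|` A| ->
  exists x y, [/\ x \in A, y \in A, x != y, x != z & y != z].
Proof.
move=> h; have /card_gt1P[x [y [+ + xy]]] : 1 < #|` (A `\ z)%fset|.
  by move: h; rewrite (cardfsD1 z); case: (z \in A) => /=; lia.
by rewrite !inE => /andP[xz xA] /andP[yz yA]; exists x, y.
Qed.

(** * Chordality of the complement excludes 2K2 *)

(** The case [u = v] is allowed: [lin] is reflexive on [P], so two edges sharing a cell satisfy the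
    condition trivially. *)
Definition no_2K2 : Prop := forall b b' a c x y,
  lin P b a c -> a != c -> lin P b' x y -> x != y ->
  exists d u v, [/\ u \in [:: a; c], v \in [:: x; y] & lin P d u v].

Lemma chordal_no_2K2 : chordal (compl_graph (@polyomino_graph P)) -> no_2K2.
Proof.
move=> chP b b' a c x y lac ac lxy xy.
(* The search over both directions and all four pairs is made boolean, so that its failure yields
   eight explicit non-links. *)
pose T d u v := [&& u \in [:: a; c], v \in [:: x; y] & lin P d u v].
suff: [|| has (fun u => has (T true u) [:: x; y]) [:: a; c]
       | has (fun u => has (T false u) [:: x; y]) [:: a; c]].
  by case/orP=> /hasP[u _ /hasP[v _ /and3P[h1 h2 h3]]]; eexists; exists u, v; split; eauto.
apply/negPn/negP; rewrite /T /= !inE !eqxx ?orbT /= !orbF !negb_or.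
case/andP=> /andP[/andP[ax1 ay1] /andP[cx1 cy1]] /andP[/andP[ax0 ay0] /andP[cx0 cy0]].
have [aP cP xP yP] := And4 (lin_meml lac) (lin_memr lac) (lin_meml lxy) (lin_memr lxy).
have nl u v : lin P true u v = false -> u \in P -> u != v.
  by move=> h uP; apply/eqP=> e; rewrite -e lin_refl in h.
have [nax nay ncx ncy] : [/\ a != x, a != y, c != x & c != y].
  by split; apply: nl => //; apply/negbTE.
pose A : P := [` aP]%fset; pose C : P := [` cP]%fset.
pose X : P := [` xP]%fset; pose Y : P := [` yP]%fset.
have G1 (U V : P) : val U != val V -> ~~ lin P true (val U) (val V) ->
   ~~ lin P false (val U) (val V) -> compl_graph (@polyomino_graph P) U V.
  move=> UV h1 h0; split; first by move=> e; rewrite e eqxx in UV.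
  by move/graphP=> [_ [[]]]; apply/negP.
have G0 (U V : P) d : lin P d (val U) (val V) ->
   ~ compl_graph (@polyomino_graph P) U V.
  by move=> l [UV]; apply; apply/graphP; split=> //; exists d.
have S (U V : P) : compl_graph (@polyomino_graph P) U V ->
   compl_graph (@polyomino_graph P) V U.
  move=> [UV nG]; split; first by move=> e; apply: UV.
  move/graphP=> [_ [d /lin_sym l]]; apply: nG; apply/graphP; split=> //.
  by exists d.
have [eAC eXY eAX eAY] :
    [/\ (A == C) = false, (X == Y) = false, (A == X) = false & (A == Y) = false].
  by rewrite -!val_eqE /=; split; apply/negbTE.
have [eCX eCY] : (C == X) = false /\ (C == Y) = false.
  by rewrite -!val_eqE /=; split; apply/negbTE.
have [eXA eXC] : (X == A) = false /\ (X == C) = false by rewrite !(eq_sym X).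
have eCA : (C == A) = false by rewrite eq_sym.
have [eYA eYX eYC] : [/\ (Y == A) = false, (Y == X) = false & (Y == C) = false].
  by rewrite !(eq_sym Y).
have GAX := G1 A X nax ax1 ax0.
have GAY := G1 A Y nay ay1 ay0.
have GCX := G1 C X ncx cx1 cx0.
have GCY := G1 C Y ncy cy1 cy0.
have NAC : ~ compl_graph (@polyomino_graph P) A C by apply: (G0 _ _ b).
have NXY : ~ compl_graph (@polyomino_graph P) X Y by apply: (G0 _ _ b').
have NU (U : P) : ~ compl_graph (@polyomino_graph P) U U by case.
(* The order alternates between the two edges: consecutive cells are unlinked, and the diagonals
   [A], [C] and [X], [Y] are the given links. *)
apply: (chP [:: A; X; C; Y]) => //; split.
  by rewrite /= !inE !negb_or eAX eAC eAY eXY eCY eXC.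
have [nA nX nC nY] : [/\ next [:: A; X; C; Y] A = X, next [:: A; X; C; Y] X = C,
    next [:: A; X; C; Y] C = Y & next [:: A; X; C; Y] Y = A].
  by rewrite /next /= !eqxx eXA eCA eCX eYA eYX eYC.
move=> U V; rewrite !inE => /or4P[] /eqP-> /or4P[] /eqP->; rewrite ?nA ?nX ?nC ?nY;
  split=> [h|[/eqP|/eqP]]; rewrite ?eqxx ?eAC ?eXY ?eAX ?eAY ?eCX ?eCY
    ?eXA ?eXC ?eCA ?eYA ?eYX ?eYC //;
  by [left | right | case: (NU _ h) | case: NAC; auto | case: NXY; auto | auto].
Qed.

(** * Relative position of lines without 2K2 *)

(** A link between the two lines runs along one of them, so its endpoint on the other line lies on
    both. *)
Lemma lines_meet {b c c' d d'} : no_2K2 ->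
  lin P b c c' -> c != c' -> lin P (~~ b) d d' -> d != d' ->
  exists2 z, lin P b c z & lin P (~~ b) d z.
Proof.
move=> H lc cc ld dd; have [e [u [v [hu hv luv]]]] := H _ _ _ _ _ _ lc cc ld dd.
have cu : lin P b c u.
  by move: hu; rewrite !inE => /orP[]/eqP-> //; apply: lin_refll lc.
have dv : lin P (~~ b) d v.
  by move: hv; rewrite !inE => /orP[]/eqP-> //; apply: lin_refll ld.
case: (eqVneq e b) luv => [->|eb] luv; first by exists v => //; apply: lin_trans luv.
exists u => //; apply: (lin_trans dv); apply: lin_sym.
by have <- : e = ~~ b by case: (e) (b) eb => [] [].
Qed.

(** After removal of the crossing cell [z], two cells remain on each line. A link between these
    pairs would put a second cell on both lines. *)
Lemma meeting_lines_short {b c d} : no_2K2 ->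
  2 < #|` line P b c| -> 2 < #|` line P (~~ b) d| -> False.
Proof.
move=> H hc hd.
have /card_gt1P[x [y [+ + xy]]] := ltnW hc; rewrite !mem_line => lx ly.
have /card_gt1P[s [t [+ + st]]] := ltnW hd; rewrite !mem_line => ls lt.
have [z] := lines_meet H (lin_trans (lin_sym lx) ly) xy (lin_trans (lin_sym ls) lt) st.
move=> /(lin_trans lx) cz /(lin_trans ls) dz.
have [a [a' [+ + aa az a'z]]] := card_gt2_avoid _ z hc.
have [e [e' [+ + ee ez e'z]]] := card_gt2_avoid _ z hd.
rewrite !mem_line => le le' la la'.
have [f [u [v [hu hv luv]]]] :=
  H _ _ _ _ _ _ (lin_trans (lin_sym la) la') aa (lin_trans (lin_sym le) le') ee.
have [cu uz] : lin P b c u /\ u != z by move: hu; rewrite !inE => /orP[]/eqP->.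
have [dv vz] : lin P (~~ b) d v /\ v != z by move: hv; rewrite !inE => /orP[]/eqP->.
case: (eqVneq f b) luv => [->|fb] luv.
  case/eqP: vz; apply: (@lin_cross b); last exact: lin_trans (lin_sym dv) dz.
  exact: lin_trans (lin_sym (lin_trans cu luv)) cz.
case/eqP: uz; apply: (@lin_cross b); first exact: lin_trans (lin_sym cu) cz.
apply: lin_trans (lin_trans _ (lin_sym dv)) dz.
by have <- : f = ~~ b by case: (f) (b) fb => [] [].
Qed.

(** A link in direction [b] would merge the two parallel lines, so it must be perpendicular. *)
Lemma parallel_rung {b c c' d d'} : no_2K2 -> ~~ lin P b c d ->
  lin P b c c' -> c != c' -> lin P b d d' -> d != d' ->
  exists u v, [/\ u \in [:: c; c'], v \in [:: d; d'] & lin P (~~ b) u v].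
Proof.
move=> H ncd lc cc ld dd; have [e [u [v [hu hv luv]]]] := H _ _ _ _ _ _ lc cc ld dd.
exists u, v; split=> //.
have <- // : e = ~~ b.
case: (eqVneq e b) luv => [->|eb] luv; last by case: (e) (b) eb => [] [].
have cu : lin P b c u.
  by move: hu; rewrite !inE => /orP[]/eqP-> //; apply: lin_refll lc.
have dv : lin P b d v.
  by move: hv; rewrite !inE => /orP[]/eqP-> //; apply: lin_refll ld.
by case/negP: ncd; apply: lin_trans (lin_trans cu luv) (lin_sym dv).
Qed.

(* At most one of two consecutive cells of [line c] carries a rung to [line d];
   a pair of cells of [line d] avoiding the foot of that rung gives a 2K2. *)
Lemma parallel_lines_short {b c c' d} : thin P -> no_2K2 -> ~~ lin P b c d ->
  lin P b c c' -> c != c' -> ~~ (2 < #|` line P b d|).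
Proof.
move=> thP H ncd lc cc; apply/negP=> hd.
have [a [a' [ca aa sa]]] := lin_consecutive lc cc.
have naa : a != a' by apply/eqP=> e; move: sa; rewrite e => /n_Sn.
have rung s t : lin P b d s -> lin P b d t -> s != t ->
    exists u v, [/\ u \in [:: a; a'], v \in [:: s; t], lin P b d v & lin P (~~ b) u v].
  move=> ds dt st.
  have nas : ~~ lin P b a s.
    by apply: contra ncd => las; apply: lin_trans (lin_trans ca las) (lin_sym ds).
  have [u [v [hu hv luv]]] := parallel_rung H nas aa naa (lin_trans (lin_sym ds) dt) st.
  by exists u, v; split=> //; move: hv; rewrite !inE => /orP[]/eqP->.
have [s [t [+ + st _ _]]] := card_gt2_avoid _ d hd; rewrite !mem_line => ds dt.
have [u [v [hu _ dv luv]]] := rung _ _ ds dt st.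
(* The third cell of the line allows a second pair that avoids the foot [v] of the first rung, so
   the second rung has another foot. *)
have [s' [t' [+ + st' sv tv]]] := card_gt2_avoid _ v hd; rewrite !mem_line => ds' dt'.
have [u' [v' [hu' hv' dv' luv']]] := rung _ _ ds' dt' st'.
have {hv' sv tv} vv : v' != v by move: hv'; rewrite !inE => /orP[]/eqP->.
have lvv := lin_trans (lin_sym dv) dv'.
have nav x : lin P b d x -> a != x.
  by move=> dx; apply: contra ncd => /eqP e; rewrite e in ca; apply: lin_trans ca (lin_sym dx).
(* Rungs from the same cell have the same foot, against [vv]. Rungs from both [a] and [a'] have
   height zero by thinness, which puts [a] on the line of [d]. *)
move: hu hu'; rewrite !inE => /orP[]/eqP eu /orP[]/eqP eu'; subst u u'.
- case/eqP: vv; apply/esym/(@lin_cross b) => //; exact: lin_trans (lin_sym luv) luv'.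
- by case/eqP: (nav _ dv); apply: (thin_no_two_rungs thP aa sa luv luv' lvv).
- by case/eqP: (nav _ dv'); apply: (thin_no_two_rungs thP aa sa luv' luv (lin_sym lvv)).
- case/eqP: vv; apply/esym/(@lin_cross b) => //; exact: lin_trans (lin_sym luv) luv'.
Qed.

(** * Construction of the brush *)

(** The spine is the line of [c]. Every maximal interval in direction [b] equals it by hypothesis,
    and every perpendicular one meets it by [lines_meet], hence is the perpendicular line through a
    spine cell. *)
Lemma brush_of_spine {b c c'} : polyomino P -> simple_polyomino P -> thin P ->
  no_2K2 -> lin P b c c' -> c != c' ->
  (forall d d', lin P b d d' -> d != d' -> lin P b c d) ->
  (forall d, ~~ (2 < #|` line P (~~ b) d|)) ->
  short_brush_polyomino P.
Proof.
move=> polP simP thP H lc cc par short.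
pose J := line P b c.
(* Each spine cell contributes at most one bristle, which bounds the size of [Is]; the filter drops
   the one-cell lines, which are not intervals. *)
pose Is := [seq line P (~~ b) p | p <- enum_fset J & 1 < #|` line P (~~ b) p|].
have IsP I : I \in Is -> exists2 p, p \in J & I = line P (~~ b) p /\ 1 < #|` I|.
  by case/mapP=> p; rewrite mem_filter => /andP[hp pJ] ->; exists p.
have memJ p : p \in J -> p \in line P (~~ b) p.
  by rewrite !mem_line => /lin_memr; apply: lin_refl.
exists J, Is; split; last first.
  by move=> I /IsP[p _ [-> h]]; have := short p; lia.
split=> //; split.
- rewrite /= map_inj_in_uniq ?filter_uniq ?fset_uniq ?andbT //.
    apply/negP=> /IsP[p pJ [eJ /card_gt1P[x [y [xJ yJ]]]]]; case/eqP.
    apply: (@lin_cross b); last by move: xJ yJ; rewrite eJ !mem_line => /lin_sym; apply: lin_trans.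
    by move: xJ yJ; rewrite !mem_line => /lin_sym; apply: lin_trans.
  move=> p q; rewrite !mem_filter => /andP[_ pJ] /andP[_ qJ] e.
  apply: (@lin_cross b); last by rewrite -mem_line e memJ.
  by move: pJ qJ; rewrite !mem_line => /lin_sym; apply: lin_trans.
- move=> K; rewrite inE; split=> [mK|/orP[/eqP->|/IsP[p pJ [-> hp]]]].
  + have [e [d [d' [dd ld eK]]]] := maximal_is_line mK.
    have [K1 _] := (maximalP K).1 mK.
    case: (eqVneq e b) ld eK => [->|eb] ld eK.
      by rewrite eK /J (line_eq (par _ _ ld dd)) eqxx.
    have ee : e = ~~ b by case: (e) (b) eb => [] [].
    rewrite ee in ld eK; have [z cz dz] := lines_meet H lc cc ld dd.
    apply/orP; right; apply/mapP; exists z; last by rewrite eK (line_eq dz).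
    by rewrite mem_filter -(line_eq dz) -eK K1 /= mem_line.
  + exact: line_is_maximal cc lc.
  + apply/maximalP; split=> //; exists (~~ b), p; split=> //.
    by move: pJ; rewrite mem_line => /lin_memr.
- by rewrite size_map size_filter; apply: leq_trans (count_size _ _) _.
- move=> I /IsP[p pJ [-> _]]; apply/fset0Pn; exists p.
  by rewrite in_fsetI pJ memJ.
Qed.

(** The first step of a path between two distinct cells is a link. A single cell has no interval
    that could serve as a spine. *)
Lemma exists_lin : polyomino P -> 1 < #|` P| ->
  exists b c d, lin P b c d /\ c != d.
Proof.
case=> _ conP /card_gt1P[x [y [xP yP xy]]].
have [[|z s] [/=]] := conP x y xP yP; first by move=> _ e; rewrite e eqxx in xy.
case/andP=> axz _ _ /andP[zP _]; have [b l] := adjacent_lin _ _ xP zP axz.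
exists b, x, z; split=> //; apply/eqP=> e.
by move: axz; rewrite e /adjacent; lia.
Qed.

Lemma no_2K2_brush : polyomino P -> simple_polyomino P -> thin P ->
  1 < #|` P| -> no_2K2 -> short_brush_polyomino P.
Proof.
move=> polP simP thP P1 H.
(* By [parallel_lines_short], a line with three cells has no parallel interval. *)
have parl b c c' d d' : lin P b c c' -> c != c' -> lin P b d d' -> d != d' ->
    2 < #|` line P b c| -> lin P b c d.
  move=> lc cc ld dd; apply: contraLR => ncd.
  by apply: (parallel_lines_short thP H _ ld dd); apply: contra ncd => /lin_sym.
case: (boolP [exists c : P, (2 < #|` line P true (val c)|) || (2 < #|` line P false (val c)|)]).
  case/existsP=> c h.
  have {c h} [b [c hc]] : exists b c, 2 < #|` line P b c|.
    by case/orP: h => h; [exists true | exists false]; exists (val c).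
  have /card_gt1P[x [y [+ + xy]]] := ltnW hc; rewrite !mem_line => cx cy.
  have lxy := lin_trans (lin_sym cx) cy; rewrite (line_eq cx) in hc.
  apply: (brush_of_spine polP simP thP H lxy xy) => [d d' ld dd|d].
    exact: parl lxy xy ld dd hc.
  by apply/negP=> /(meeting_lines_short H hc).
move=> /existsPn short0.
have short b c : ~~ (2 < #|` line P b c|).
  apply/negP=> h; have /card_gt1P[x [_ [+ _ _]]] := ltnW h; rewrite mem_line => cx.
  move: h; rewrite (line_eq cx); have /= := short0 [` lin_memr cx]%fset.
  by rewrite negb_or => /andP[h1 h0]; case: b {cx} => h; [case/negP: h1|case/negP: h0].
have [b [c [c' [lc cc]]]] := exists_lin polP P1.
pose par := [exists d : P, [exists d' : P,
  [&& lin P b (val d) (val d'), val d != val d' & ~~ lin P b c (val d)]]].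
case: (boolP par) => [/existsP[d /existsP[d' /and3P[ld dd ncd]]]|npar]; last first.
  apply: (brush_of_spine polP simP thP H lc cc) => // d d' ld dd.
  move: npar; rewrite negb_exists => /forallP/(_ [` lin_meml ld]%fset).
  rewrite negb_exists => /forallP/(_ [` lin_memr ld]%fset) /=.
  by rewrite ld dd /= negbK.
have [u [v [hu hv luv]]] := parallel_rung H ncd lc cc ld dd.
have cu : lin P b c u by move: hu; rewrite !inE => /orP[]/eqP-> //; apply: lin_refll lc.
have dv : lin P b (val d) v by move: hv; rewrite !inE => /orP[]/eqP-> //; apply: lin_refll ld.
have uv : u != v.
  by apply: contra ncd => /eqP e; rewrite -e in dv; apply: lin_trans cu (lin_sym dv).
(* The spine is now the rung from [u] to [v]. A parallel of it through [e] would cross the lines of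
   [c] and [d] at [z] and [z'], giving a second rung between them. *)
apply: (brush_of_spine polP simP thP H luv uv) => [e e' le ee|//].
apply/negPn/negP=> nue.
have [z cz ez] := lines_meet H lc cc le ee.
have [z' dz' ez'] := lines_meet H ld dd le ee.
have uz := lin_trans (lin_sym cu) cz; have vz' := lin_trans (lin_sym dv) dz'.
have zz' := lin_trans (lin_sym ez) ez'.
have nuz : u != z by apply: contra nue => /eqP->; apply: lin_sym.
have [p [q [up pq sq]]] := lin_consecutive uz nuz.
have npq : p != q by apply/eqP=> epq; move: sq; rewrite epq => /n_Sn.
(* As lines have at most two cells, the consecutive cells [p] and [q] are [u] and [z] in some order.
   The two rungs are thus neighbours, against thinness. *)
have two w : lin P b u w -> (w == u) || (w == z).
  move=> uw; rewrite -[_ || _]negbK negb_or; apply/negP=> /andP[wu wz].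
  case/negP: (short b u); rewrite (cardfsD1 w) mem_line uw ltnS.
  by apply/card_gt1P; exists u, z; rewrite !in_fsetD1 !mem_line !(eq_sym _ w) wu wz uz
    (lin_refll uz).
have nzz : z != z'.
  by apply: contra ncd => /eqP ez0; rewrite -ez0 in dz'; apply: lin_trans cz (lin_sym dz').
have /orP[] := two _ up => /eqP ep; have /orP[] := two _ (lin_trans up pq) => /eqP eq; subst p q.
- by rewrite eqxx in npq.
- by case/eqP: uv; apply: (thin_no_two_rungs thP pq sq luv zz' vz').
- by case/eqP: nzz; apply: (thin_no_two_rungs thP pq sq zz' luv (lin_sym vz')).
- by rewrite eqxx in npq.
Qed.

(** * Split graphs and the converse *)

(** For consecutive vertices [a], [b], [c], [d] of an induced cycle, the non-edges [ac] and [bd]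
    each have an end in the independent set [A]. Unless these ends are [a] and [d], they are
    adjacent, a contradiction. *)
Lemma split_cover_chordal (T : eqType) (e : T -> T -> Prop) (A : pred T) :
  (forall x y, A x -> A y -> ~ e x y) ->
  (forall x y, ~~ A x -> ~~ A y -> x <> y -> e x y) -> chordal e.
Proof.
move=> indA clA [//|a [//|b [//|c [//|d s]]]] _ [U Hc].
move: (U); rewrite /= !inE !negb_or -!andbA.
case/and5P=> ab ac ad aS /and5P[bc bd bS cd /and3P[cS dS sS]].
have [nba nca ncb] : [/\ (b == a) = false, (c == a) = false & (c == b) = false].
  by split; rewrite eq_sym; apply/negbTE.
have [nda ndb ndc] : [/\ (d == a) = false, (d == b) = false & (d == c) = false].
  by split; rewrite eq_sym; apply/negbTE.
set w := [:: a, b, c, d & s] in Hc.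
have na : next w a = b by rewrite /next /= eqxx.
have nb : next w b = c by rewrite /next /= nba eqxx.
have nc : next w c = d by rewrite /next /= nca ncb eqxx.
have inj : injective (next w) by apply: can_inj (prev_next _).
have [aw bw cw dw] : [/\ a \in w, b \in w, c \in w & d \in w].
  by rewrite !inE !eqxx !orbT.
have edge x y : x \in w -> y \in w -> y = next w x -> e x y.
  by move=> xw yw h; apply/(Hc x y xw yw); left.
have noA x y : e x y -> A x -> A y -> False by move=> exy Ax Ay; apply: (indA x y).
have eab : e a b by apply: edge.
have ebc : e b c by apply: edge.
have ecd : e c d by apply: edge.
have nac : ~ e a c.
  by move/(Hc a c aw cw); rewrite na nc => -[] /eqP; rewrite ?ncb // (negbTE ad).
have nbd : ~ e b d.
  move/(Hc b d bw dw); rewrite nb -na => -[/eqP|/inj/eqP].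
    by rewrite ndc.
  by rewrite (negbTE ad).
have Aac : A a || A c.
  by apply/negPn/negP; rewrite negb_or => /andP[h h']; apply/nac/clA=> //; apply/eqP.
have Abd : A b || A d.
  by apply/negPn/negP; rewrite negb_or => /andP[h h']; apply/nbd/clA=> //; apply/eqP.
case/orP: Abd => hbd; case/orP: Aac => hac.
- exact: noA eab hac hbd.
- exact: noA ebc hbd hac.
(* With [a] and [d] in [A], both [b] and the successor of [d] lie in the clique, so they are
   neighbours on the cycle. Then that successor is [c], forcing [d = b], or [a], which lies in
   [A]. *)
- have nAb : ~~ A b by apply/negP; apply: noA eab hac.
  have xw : next w d \in w by rewrite mem_next.
  have edx : e d (next w d) by apply: edge.
  have nAx : ~~ A (next w d) by apply/negP; apply: noA edx hbd.
  have bx : b <> next w d by rewrite -na => /inj/eqP; rewrite (negbTE ad).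
  move/(Hc b _ bw xw): (clA _ _ nAb nAx bx); rewrite nb.
  case=> [/esym|]; first by rewrite -nb => /inj/eqP; rewrite (negbTE bd).
  rewrite -na => /inj ex.
  by move: nAx; rewrite -ex hac.
- exact: noA ecd hac hbd.
Qed.

(** In the complement the spine is the independent set. Two linked cells off the spine would share a
    bristle with its spine cell [z], giving that bristle three cells. *)
Lemma short_brush_chordal :
  short_brush_polyomino P -> chordal (compl_graph (@polyomino_graph P)).
Proof.
case=> J [Is [[_ [_ maxP _ meet] short]]].
have /maxP : J \in J :: Is by rewrite inE eqxx.
case/maximal_is_line=> b [c [_ [_ _ eJ]]].
apply: (@split_cover_chordal _ _ (fun x : P => val x \in J)) => [x y|x y].
  rewrite eJ !mem_line => cx cy [xy nG]; apply: nG; apply/graphP; split=> //.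
  by exists b; apply: lin_trans (lin_sym cx) cy.
move=> xJ yJ xy; split=> // /graphP[_ [d lxy]].
have nxy : val x != val y by apply/eqP=> /val_inj.
have /maxP := line_is_maximal nxy lxy.
have xL : val x \in line P d (val x) by rewrite mem_line (lin_refll lxy).
have yL : val y \in line P d (val x) by rewrite mem_line.
rewrite inE => /orP[/eqP eL|LI]; first by rewrite -eL xL in xJ.
have /fset0Pn[z] := meet _ LI; rewrite in_fsetI => /andP[zL zJ].
have [zx zy] : z != val x /\ z != val y.
  by split; apply/eqP=> ez; [case/negP: xJ | case/negP: yJ]; rewrite -ez.
move: (short _ LI); rewrite (cardfsD1 z) zL add1n => -[card1].
suff : 1 < #|` (line P d (val x) `\ z)%fset| by rewrite card1.
apply/card_gt1P; exists (val x), (val y).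
by rewrite !in_fsetD1 xL yL !(eq_sym _ z) zx zy.
Qed.

End Lines.

Theorem theorem4p8 (P : {fset cell})
    (P_polyomino : polyomino P) (P_simple : simple_polyomino P)
    (P_thin : thin P) (P_not_single_cell : 1 < #|` P|) :
  chordal (compl_graph (@polyomino_graph P)) <-> short_brush_polyomino P.
Proof.
split; last exact: short_brush_chordal.
by move/chordal_no_2K2; apply: no_2K2_brush.
Qed.
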